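(* For every $\epsilon>0$, there exists a deterministic distributed algorithm in the CONGEST model running in $O((1/\epsilon)^{1.71}\cdot\log^2 n)$ rounds that computes an orientation of the edges of $G$ such that for each vertex $v$, $|\mathrm{outdeg}(v)-\mathrm{indeg}(v)|\le\epsilon\deg(v)+12$.
   Context: $G=(V,E)$ is a simple undirected graph with $n$ vertices, which is also the communication network; $\deg(v)$, $\mathrm{outdeg}(v)$, $\mathrm{indeg}(v)$ denote degree, outdegree and indegree of $v$ with respect to the computed orientation. In the CONGEST model, vertices have unique IDs and operate in synchronous rounds; in each round every vertex sends a message of $O(\log n)$ bits to each neighbor, receives messages, and computes locally. *)

(* Defs.v *)
From mathcomp Require Import all_boot all_order all_algebra.
From mathcomp Require Import reals exp.

Set Implicit Arguments.
Unset Strict Implicit.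
Unset Printing Implicit Defensive.

Import Order.TTheory GRing.Theory Num.Theory.

Definition simple_graph (V : finType) (e : rel V) : Prop :=
  symmetric e /\ irreflexive e.

(* IDs of O(log n) bits: injective into {1, ..., n ^ c}, where n = #|V|. *)
Definition unique_ids (c : nat) (V : finType) (ident : V -> nat) : Prop :=
  injective ident /\ forall v, 0 < ident v <= #|V| ^ c.

(* Port i of v leads to the i-th element of [port v]; the order is arbitrary,
   and nothing relates the two port numbers of an edge. *)
Definition port_numbering (V : finType) (e : rel V) (port : V -> seq V) : Prop :=
  forall v, uniq (port v) /\ port v =i e v.

(* A deterministic synchronous message-passing algorithm that orients edges.
   Local computation is unrestricted. A vertex starts with n, its ID and its
   degree only: it accesses its neighbors through its ports and learns their
   IDs only by communication. As n is known to all vertices, they all stop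
   after the same number [rounds n] of rounds. *)
Record algorithm := Algorithm {
  state : Type;
  (* number of vertices, own ID, own degree *)
  init : nat -> nat -> nat -> state;
  (* the message sent through a given port *)
  send : state -> nat -> seq bool;
  (* the received messages are listed by port *)
  receive : state -> seq (seq bool) -> state;
  rounds : nat -> nat;
  (* whether the edge at a given port is directed away from this vertex *)
  output : state -> nat -> bool
}.

Section Execution.
Variables (A : algorithm) (V : finType) (ident : V -> nat) (port : V -> seq V).

Fixpoint run (t : nat) (v : V) : state A :=
  if t is t'.+1 then
    receive (run t' v) [seq send (run t' u) (index v (port u)) | u <- port v]
  else init A #|V| (ident v) (size (port v)).

Definition congest (b : nat) : Prop :=
  forall t v i, t < rounds A #|V| -> i < size (port v) ->
    size (send (run t v) i) <= b * up_log 2 #|V|.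

Definition computed_arc : rel V :=
  fun v u => (u \in port v) && output (run (rounds A #|V|) v) (index u (port v)).

End Execution.

Definition is_orientation (V : finType) (e o : rel V) : Prop :=
  (forall u v, o u v -> e u v) /\ (forall u v, e u v -> o u v (+) o v u).

Definition deg (V : finType) (e : rel V) (v : V) : nat := #|[set u | e v u]|.
Definition outdeg (V : finType) (o : rel V) (v : V) : nat := #|[set u | o v u]|.
Definition indeg (V : finType) (o : rel V) (v : V) : nat := #|[set u | o u v]|.

(* The real bound is rounded up to a whole number of rounds: as eps tends to
   infinity it tends to 0, although the endpoints of an edge need at least one
   round of communication to agree on a direction. When eps <= 1 and n >= 2 the rounding is absorbed by
   the constant C. *)
Definition round_bound (R : realType) (C eps : R) (n : nat) : int :=
  Num.ceil (C * ((1 / eps) `^ (171 / 100)) * (ln n%:R) ^+ 2)%R.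

(* Main.v *)
Require Import Defs.
From mathcomp Require Import all_boot all_order all_algebra.
From mathcomp Require Import zify ring lra.
From mathcomp Require Import reals exp.
From Stdlib Require Import FunctionalExtensionality.

(* The edges are partitioned into directed paths, and the imbalance of a vertex
   is at most the number of paths that end there.  At first every edge is a path
   by itself, directed by the IDs.  A stage multiplies the number of paths ending
   at each vertex by about 2/3 and at most doubles their length, so log_{3/2}(1/eps)
   stages suffice, with paths of length at most 2 (1/eps)^{log_{3/2} 2}, and
   log_{3/2} 2 < 1.71.  In a stage every vertex divides the paths ending there into
   triples.  If every triple owns one of its paths and no path is owned at both
   ends, each vertex can merge the owned paths two by two: this removes two of every
   six path ends, and each path is merged at one end only.

   Ownership is a sinkless orientation, computed in O(log n) phases of O(log n)
   messages along paths.  Call a triple without a path a sink.  From a sink, go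
   through the three paths to the triples that own them, then through the two other
   paths of each of these, and so on: the branching forces an unowned path within
   distance O(log n).  In a phase every triple first learns its distance to an
   unowned path; then, for j decreasing, each sink at distance j > 0 takes a path
   owned by a triple at a smaller distance, which becomes the sink instead.  Finally
   all sinks are next to unowned paths and claim them; a path is claimed by at most
   two of them, hence a phase halves the number of sinks. *)

Set Implicit Arguments.
Unset Strict Implicit.
Unset Printing Implicit Defensive.

(** * Consecutive triples and pairs in a list *)

Section Blocks.
Variable T : eqType.
Implicit Types (l : seq T) (x y : T).

Definition triple l x :=
  [seq y <- l | (index y l %/ 3 == index x l %/ 3) &&
                (index x l %/ 3 < size l %/ 3)].

Definition adjacent l x :=
  if x \in l then nth x l (if odd (index x l) then (index x l).-1 else (index x l).+1)
  else x.

Lemma triple_eq l x y : y \in triple l x -> triple l y = triple l x.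
Proof.
rewrite mem_filter => /andP[/andP[/eqP xy _] _].
by apply: eq_filter => z; rewrite xy.
Qed.

Lemma count_index l (P : pred nat) : uniq l ->
  count (fun x => P (index x l)) l = count P (iota 0 (size l)).
Proof.
move=> ul; rewrite -[LHS]/(count (preim (index^~ l) P) l) -count_map; congr (count P _).
case: l ul => // x0 l ul; apply: (@eq_from_nth _ 0); rewrite ?size_map ?size_iota //.
move=> i il; rewrite (nth_map x0) // nth_iota // index_uniq //.
Qed.

Lemma size_triple l x : uniq l -> x \in triple l x -> size (triple l x) = 3.
Proof.
move=> ul; rewrite mem_filter eqxx /= => /andP[kl _]; rewrite size_filter kl.
set k := index x l %/ 3 in kl *.
under eq_count do rewrite andbT.
rewrite (count_index (fun i => i %/ 3 == k)) //.
have kl3 : k * 3 + 3 <= size l.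
  by rewrite addnC -mulSn (leq_trans _ (leq_trunc_div (size l) 3)) // leq_mul2r kl.
rewrite -(subnKC kl3) -addnA !iotaD !count_cat add0n.
have -> : count (fun i => i %/ 3 == k) (iota 0 (k * 3)) = 0.
  apply/eqP; rewrite -leqn0 leqNgt -has_count; apply/hasPn => i.
  by rewrite mem_iota /= add0n => ik; rewrite neq_ltn ltn_divLR ?ik.
have -> : count (fun i => i %/ 3 == k) (iota (k * 3) 3) = 3.
  by rewrite -[X in iota X _]addn0 iotaDl count_map /= !divnMDl // !addn0 eqxx.
suff -> : count (fun i => i %/ 3 == k) (iota (k * 3 + 3) (size l - (k * 3 + 3))) = 0.
  by [].
apply/eqP; rewrite -leqn0 leqNgt -has_count; apply/hasPn => i.
rewrite mem_iota => /andP[ki _]; rewrite neq_ltn orbC leq_divRL //.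
by rewrite mulSn addnC ki.
Qed.

Lemma count_triple l : uniq l ->
  count (fun x => x \in triple l x) l = 3 * (size l %/ 3).
Proof.
move=> ul; rewrite (eq_in_count (a2 := fun x => index x l %/ 3 < size l %/ 3)).
  rewrite (count_index (fun i => i %/ 3 < size l %/ 3)) //.
  rewrite -{2}(subnKC (leq_trunc_div (size l) 3)) iotaD count_cat add0n.
  rewrite (eq_in_count (a2 := predT)) ?count_predT ?size_iota; last first.
    by move=> i; rewrite mem_iota add0n /= => im; rewrite ltn_divLR // im.
  rewrite (eq_in_count (a2 := pred0)) ?count_pred0 ?addn0 1?mulnC //.
  move=> i; rewrite mem_iota => /andP[im _]; apply/negbTE.
  by rewrite -leqNgt leq_divRL // mulnC.
by move=> x xl; rewrite mem_filter eqxx xl andbT.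
Qed.

Lemma adjacent_mem l x : x \in l -> adjacent l x \in l.
Proof.
move=> xl; rewrite /adjacent xl; set i := (if _ then _ else _).
by have [il|li] := ltnP i (size l); [apply: mem_nth | rewrite nth_default].
Qed.

Lemma index_adjacent l x : uniq l -> x \in l -> adjacent l x != x ->
  index (adjacent l x) l =
  if odd (index x l) then (index x l).-1 else (index x l).+1.
Proof.
move=> ul xl; rewrite /adjacent xl; set i := (if _ then _ else _).
have [il|li] := ltnP i (size l); first by rewrite index_uniq.
by rewrite nth_default // eqxx.
Qed.

Lemma adjacentK l x : uniq l -> adjacent l (adjacent l x) = x.
Proof.
move=> ul; have [xl|xl] := boolP (x \in l); last first.
  by rewrite /adjacent !(negPf xl).
have [E|nx] := eqVneq (adjacent l x) x; first by rewrite !E.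
rewrite {1}/adjacent adjacent_mem // index_adjacent //.
case ox: (odd (index x l)).
  by case: (index x l) (nth_index (adjacent l x) xl) ox => // i E /= /negPf->.
by rewrite /= ox /= nth_index.
Qed.

Lemma odd_index_adjacent l x : uniq l -> x \in l -> adjacent l x != x ->
  odd (index (adjacent l x) l) = ~~ odd (index x l).
Proof.
move=> ul xl nx; rewrite index_adjacent //; case: ifP => ox /=; last by rewrite ox.
by case: (index x l) ox => //= i /negPf.
Qed.

Lemma adjacent_fix l x : uniq l -> x \in l ->
  (adjacent l x == x) = ~~ odd (index x l) && ((index x l).+1 == size l).
Proof.
move=> ul xl; rewrite /adjacent xl; have il : index x l < size l by rewrite index_mem.
case: ifP => ox /=.
  case E: (index x l) ox il => [|i] //= ox il; apply/negbTE.
  rewrite -[X in _ != X](nth_index x xl) E nth_uniq //; last exact: ltnW.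
  by rewrite neq_ltn ltnSn.
have [il'|li] := ltnP (index x l).+1 (size l).
  rewrite -[X in _ == X](nth_index x xl) nth_uniq // !eqn_leq ltnn /=.
  by rewrite [size l <= _]leqNgt il' andbF.
by rewrite nth_default // eqxx eqn_leq li il.
Qed.

Lemma count_adjacent l : uniq l ->
  count (fun x => adjacent l x == x) l = odd (size l).
Proof.
move=> ul; rewrite (eq_in_count (fun x => adjacent_fix (x := x) ul)).
rewrite (count_index (fun i => ~~ odd i && (i.+1 == size l))) //.
case: (size l) => // m; rewrite -addn1 iotaD count_cat /= add0n addn1 eqxx andbT.
rewrite (eq_in_count (a2 := pred0)) ?count_pred0 ?addn0 // => i.
by rewrite mem_iota add0n /= eqSS => im; rewrite (ltn_eqF im) andbF.
Qed.

End Blocks.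

Fixpoint bits w x := if w is w'.+1 then odd x :: bits w' x./2 else [::].
Fixpoint value (s : seq bool) := if s is b :: s' then b + (value s').*2 else 0.

Lemma size_bits w x : size (bits w x) = w.
Proof. by elim: w x => //= w IH x; rewrite IH. Qed.

Lemma bitsK w x : x < 2 ^ w -> value (bits w x) = x.
Proof.
elim: w x => [|w IH] x /=; first by case: x.
by rewrite expnS mul2n => xw; rewrite IH ?ltn_half_double // odd_double_half.
Qed.

(** * One phase of the sinkless orientation *)

Section Phase.

Variables (S : finType) (cls : S -> {set S}) (far : S -> S).
Variables (key : S -> nat) (dir : S -> bool).
Implicit Types (own : S -> bool) (lev : S -> option nat) (s t : S).

Definition free own s := ~~ own s && ~~ own (far s).
Definition has_owner own s := [exists t in cls s, own t].
Definition sink own s := (s \in cls s) && ~~ has_owner own s.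
Definition labelled lev s := [exists t in cls s, lev t].

Definition chosen (P : pred S) s :=
  [&& s \in cls s, P s & [forall t in cls s, P t ==> (key s <= key t)]].

Definition seed own s := if chosen (free own) s then Some 0 else None.

Definition heard own lev s := own (far s) && labelled lev (far s).

Definition bfs own j lev s :=
  if labelled lev s then lev s
  else if chosen (heard own lev) s then Some j else None.

(* When both ends of an unowned path request it, the end it leaves from wins. *)
Definition request own j lev s := sink own s && (lev s == Some j).

Definition move j lev own s :=
  (s \in cls s) &&
  (if request own j lev s then request own j lev (far s) ==> dir s
   else own s && ~~ request own j lev (far s)).

Fixpoint levels own j :=
  if j is i.+1 then bfs own j (levels own i) else seed own.

Fixpoint moves lev j own :=
  if j is i.+1 then moves lev i (move j lev own) else move 0 lev own.

Definition phase D own := moves (levels own D) D own.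

Hypothesis cls_eq : forall s t, t \in cls s -> cls t = cls s.
Hypothesis card_cls : forall s, s \in cls s -> #|cls s| = 3.
Hypothesis key_inj :
  forall s t, s \in cls s -> t \in cls s -> key t = key s -> t = s.
Hypothesis farK : involutive far.
Hypothesis dir_far : forall s, s \in cls s -> dir (far s) = ~~ dir s.

Definition valid own :=
  [/\ forall s, own s -> s \in cls s,
      forall s, own s -> ~~ own (far s)
    & forall s t, own s -> own t -> t \in cls s -> t = s].

Definition sinks own := [set s | sink own s].
Definition edges own := [set s | own s || own (far s)].

Lemma cls_self s t : t \in cls s -> t \in cls t.
Proof. by move=> ts; rewrite (cls_eq ts). Qed.

Lemma cls_sym s t : s \in cls s -> t \in cls s -> s \in cls t.
Proof. by move=> ss ts; rewrite (cls_eq ts). Qed.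

Lemma card_bigcup_cls (X : {set S}) :
  {in X, forall s, s \in cls s} ->
  {in X &, forall s t, t \in cls s -> t = s} ->
  #|\bigcup_(s in X) cls s| = 3 * #|X|.
Proof.
move=> Xcls Xuniq; rewrite -sum1_card.
transitivity (\sum_(t : S) \sum_(s in X) (t \in cls s)).
  rewrite big_mkcond; apply: eq_bigr => t _; case: ifPn => [|tX].
    case/bigcupP=> s sX ts; rewrite (bigD1 s) //= ts big1 // => s' /andP[s'X].
    apply: contraNeq; rewrite eqb0 negbK => ts'.
    apply/eqP; apply: Xuniq => //; rewrite -(cls_eq ts) (cls_eq ts').
    exact: Xcls.
  rewrite big1 // => s sX; apply/eqP; rewrite eqb0.
  by apply: contra tX => ts; apply/bigcupP; exists s.
rewrite exchange_big /= (eq_bigr (fun=> 3)) ?sum_nat_const 1?mulnC //.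
move=> s sX; rewrite -(card_cls (Xcls s sX)) -sum1_card [RHS]big_mkcond.
by apply: eq_bigr => t _; case: (t \in cls s).
Qed.

Lemma card_sinks own : valid own ->
  #|sinks own| + 3 * #|[set s | own s]| = #|[set s | s \in cls s]|.
Proof.
case=> own_cls own_far own_uniq; rewrite -card_bigcup_cls; first last.
- by move=> s t; rewrite !inE => os ot; apply: own_uniq.
- by move=> s; rewrite inE => /own_cls.
rewrite -cardsUI (_ : _ :&: _ = set0) ?cards0 ?addn0; last first.
  apply/setP=> t; rewrite !inE; apply/negP => /andP[/andP[tt /negP no]].
  case/bigcupP=> s; rewrite inE => os ts; case: no.
  by apply/existsP; exists s; rewrite os andbT (cls_sym (own_cls _ os)).
apply: eq_card => t; rewrite !inE; apply/orP/idP => [[/andP[]|]//|tt].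
  by case/bigcupP=> s _ /cls_self.
have [/existsP[s /andP[st os]]|no] := boolP (has_owner own t); last first.
  by left; rewrite /sink tt.
by right; apply/bigcupP; exists s; rewrite ?inE //; apply: cls_sym.
Qed.

Lemma card_edges own : valid own -> #|edges own| = 2 * #|[set s | own s]|.
Proof.
case=> _ own_far _; have -> : edges own = [set s | own s] :|: far @^-1: [set s | own s].
  by apply/setP=> s; rewrite !inE.
rewrite -[LHS]addn0 -{1}(cards0 S).
have <- : [set s | own s] :&: far @^-1: [set s | own s] = set0.
  by apply/setP=> s; rewrite !inE; apply/negP => /andP[/own_far/negP].
rewrite cardsUI mul2n -addnn; congr (_ + _).
by rewrite card_preimset //; apply: (can_inj farK).
Qed.

Lemma chosen_uniq P s t : chosen P s -> chosen P t -> t \in cls s -> t = s.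
Proof.
case/and3P=> ss Ps /forall_inP mins /and3P[tt Pt /forall_inP mint] ts.
apply: key_inj => //; apply/eqP; rewrite eqn_leq.
rewrite (implyP (mins _ ts) Pt) andbT.
by apply: (implyP (mint _ _) Ps); apply: cls_sym.
Qed.

Lemma ex_chosen (P : pred S) s :
  s \in cls s -> P s -> exists2 t, t \in cls s & chosen P t.
Proof.
move=> ss Ps; pose Q t := (t \in cls s) && P t.
have Qs : Q s by rewrite /Q ss.
case: (arg_minnP key Qs) => t /andP[ts Pt] mint; exists t => //.
rewrite /chosen (cls_self ts) Pt; apply/forall_inP=> u; rewrite (cls_eq ts).
by move=> us; apply/implyP=> Pu; apply: mint; rewrite /Q us.
Qed.

Lemma labelled_cls lev s t : t \in cls s -> labelled lev t = labelled lev s.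
Proof. by move=> ts; rewrite /labelled (cls_eq ts). Qed.

Lemma has_owner_cls own s t : t \in cls s -> has_owner own t = has_owner own s.
Proof. by move=> ts; rewrite /has_owner (cls_eq ts). Qed.

Lemma bfs_labelled own j lev s :
  labelled lev s -> labelled (bfs own j lev) s.
Proof.
case/existsP=> t /andP[ts lt]; apply/existsP; exists t; rewrite ts /bfs.
by rewrite ifT //; apply/existsP; exists t; rewrite (cls_self ts).
Qed.

Lemma levels_labelled own i j s : i <= j ->
  labelled (levels own i) s -> labelled (levels own j) s.
Proof.
move=> /subnK <-; elim: (j - i) => //= k IH ls.
by apply: bfs_labelled; apply: IH.
Qed.

(* In the forest where a triple hangs below the triple at the other end of the path
   it owns, every unlabelled triple has at least two unlabelled children. *)
Lemma unlabelled_growth own D s : valid own -> sink own s ->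
  ~~ labelled (levels own D) s -> forall k, k <= D ->
  exists2 X : {set S}, 2 ^ k <= #|X| &
    {in X, forall x, [/\ x \in cls x, ~~ own x
                       & ~~ labelled (levels own (D - k)) x]}.
Proof.
move=> [own_cls own_far own_uniq] /andP[ss /existsPn no] nls.
elim=> [|k IH] kD.
  exists [set s]; rewrite ?cards1 // => x; rewrite inE => /eqP->.
  by rewrite subn0; split=> //; have:= no s; rewrite ss.
have [X cardX XP] := IH (ltnW kD); pose Y := far @: X.
have Dk : D - k = (D - k.+1).+1 by rewrite subnSK.
have own_far_X x : x \in X -> own (far x).
  move=> /XP[xx nox nlx]; apply: contraNT nlx => nofx.
  apply: (@levels_labelled _ 0) => //.
  have [|t tx ct] := @ex_chosen (free own) x xx; first by rewrite /free nox.
  by apply/existsP; exists t; rewrite tx /= /seed ct.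
have ownY y : y \in Y -> own y by case/imsetP=> x /own_far_X ? ->.
have cardY : #|Y| = #|X| by rewrite card_imset //; apply: (can_inj farK).
have cardU : #|\bigcup_(y in Y) cls y| = 3 * #|X|.
  rewrite card_bigcup_cls ?cardY // => [y /ownY/own_cls //|y z /ownY oy /ownY oz].
  exact: own_uniq.
exists ((\bigcup_(y in Y) cls y) :\: Y).
  rewrite cardsD (setIidPr _) ?cardU ?cardY; last first.
    by apply/subsetP=> y yY; apply/bigcupP; exists y => //; apply/own_cls/ownY.
  by rewrite mulSn addKn expnS leq_mul2l.
move=> z; rewrite inE => /andP[zY /bigcupP[y yY zy]].
rewrite (labelled_cls _ zy); split; first exact: cls_self zy.
  by apply: contra zY => oz; rewrite (own_uniq _ _ (ownY _ yY) oz zy).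
case/imsetP: yY => x xX yE; have [xx nox] := XP x xX; apply: contra.
rewrite {zy}yE Dk => lfx.
have [lx|nlx] := boolP (labelled (levels own (D - k.+1)) x).
  exact: bfs_labelled.
have [|t tx ct] := @ex_chosen (heard own (levels own (D - k.+1))) x xx.
  by rewrite /heard own_far_X.
by apply/existsP; exists t; rewrite tx /= /bfs (labelled_cls _ tx) (negPf nlx) ct.
Qed.

Lemma sink_labelled own D s : valid own -> #|S| < 2 ^ D -> sink own s ->
  labelled (levels own D) s.
Proof.
move=> ok SD sk; apply: contraT => nl.
have [X cardX _] := unlabelled_growth ok sk nl (leqnn D).
by have := leq_trans (leq_trans SD cardX) (max_card _); rewrite ltnn.
Qed.

Definition single lev := forall s t, lev s -> lev t -> t \in cls s -> t = s.

Definition ladder own lev n := forall s r, lev s = Some r -> r < n ->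
  s \in cls s /\
  if r is r'.+1 then
    own (far s) /\ exists2 t, t \in cls (far s) &
                   exists2 r'', lev t = Some r'' & r'' <= r'
  else free own s.

Lemma levels_single own j : single (levels own j).
Proof.
elim: j => [|j IH] s t /=.
  rewrite /seed; case: ifP => // cs _; case: ifP => // ct _; exact: (chosen_uniq cs).
rewrite /bfs => ls lt ts; move: ls lt; rewrite (labelled_cls _ ts).
case: ifP => [_ ls lt|_]; first exact: IH ls lt ts.
case: ifP => // cs _; case: ifP => // ct _; exact: (chosen_uniq cs).
Qed.

Lemma levels_le own j s r : levels own j s = Some r -> r <= j.
Proof.
elim: j s r => [|j IH] s r /=; first by rewrite /seed; case: ifP => // _ [<-].
rewrite /bfs; case: ifP => _; first by move/IH/leqW.
by case: ifP => // _ [<-].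
Qed.

Lemma levels_ladder own j n : ladder own (levels own j) n.
Proof.
move=> s r + _; elim: j s r => [|j IH] s r.
  by rewrite /= /seed; case: ifP => // /and3P[ss fs _] [<-].
rewrite /= /bfs; case: ifP => lab; last first.
  case: ifP => // /and3P[ss /andP[ofs /existsP[t /andP[tfs lt]]] _] [<-].
  split=> //; split=> //; exists t => //.
  case E: (levels own j t) lt => [r'|] // _; exists r'; last exact: levels_le E.
  by rewrite ifT //; apply/existsP; exists t; rewrite (cls_self tfs) E.
move/IH=> [ss]; case: r => [|r]; first by split.
move=> [ofs [t tfs [r' Er' le]]]; split=> //; split=> //; exists t => //.
exists r' => //; rewrite ifT //; apply/existsP; exists t.
by rewrite (cls_self tfs) Er'.
Qed.

Lemma request_sink own j lev s : request own j lev s -> sink own s.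
Proof. by case/andP. Qed.

Lemma sink_nown own s t : sink own s -> t \in cls s -> ~~ own t.
Proof. by move=> /andP[ss /existsPn /(_ t)] + ts; rewrite ts. Qed.

Lemma request_nown own j lev s : request own j lev s -> ~~ own s.
Proof.
by move=> /request_sink sk; apply: (sink_nown sk); case/andP: sk.
Qed.

Lemma move_valid own lev j : valid own -> single lev -> valid (move j lev own).
Proof.
move=> [own_cls own_far own_uniq] lev1; split=> [s /andP[]//|s|s t].
  case/andP=> ss; rewrite /move negb_and farK; case: ifP => rs.
    case: ifP => rfs /= ds; first by rewrite dir_far // ds orbT.
    by rewrite andbF orbT.
  case/andP=> os nr; rewrite (negPf nr) (negPf (own_far _ os)) /=.
  by rewrite orbT.
case/andP=> ss; case: ifP => rs.
  move=> _ /andP[tt]; case: ifP => [rt _ ts|_ /andP[ot _] ts]; last first.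
    by have := sink_nown (request_sink rs) ts; rewrite ot.
  by case/andP: rs rt => _ /eqP ls /andP[_ /eqP lt]; apply: lev1; rewrite ?ls ?lt.
case/andP=> os _ /andP[tt]; case: ifP => [rt _ ts|_ /andP[ot _] ts].
  by have := sink_nown (request_sink rt) (cls_sym ss ts); rewrite os.
exact: own_uniq.
Qed.

Lemma edges_move own lev j : valid own -> edges (move j lev own) =
  edges own :|: [set s | request own j lev s || request own j lev (far s)].
Proof.
case=> own_cls own_far own_uniq.
have rcls s : request own j lev s -> s \in cls s by case/request_sink/andP.
apply/setP=> s; rewrite !inE /move farK.
case rs: (request own j lev s); case rf: (request own j lev (far s)) => /=.
- by rewrite (rcls _ rs) (rcls _ rf) /= orbT dir_far ?rcls //; case: (dir s).
- by rewrite (rcls _ rs) !orbT.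
- by rewrite (rcls _ rf) !orbT.
rewrite !andbT orbF; congr (_ || _).
  by case os: (own s); rewrite ?andbF ?own_cls.
by case os: (own (far s)); rewrite ?andbF ?own_cls.
Qed.

Definition targeted own lev n := forall s, sink own s ->
  exists2 t, t \in cls s & exists2 r, lev t = Some r & r < n.

Lemma move_owner_request own j lev n s : j < n -> ladder own lev n ->
  0 < j -> request own j lev s -> own (far s).
Proof.
move=> jn lad j0 /andP[_ /eqP/lad/(_ jn)[_]].
by case: j j0 jn => // j _ _ [].
Qed.

Lemma request_far own j lev n s : valid own -> j < n -> ladder own lev n ->
  0 < j -> request own j lev s -> ~~ request own j lev (far s).
Proof.
move=> ok jn lad j0 rs; apply/negP => /request_nown.
by rewrite (move_owner_request jn lad j0 rs).
Qed.

(* A move at level j > 0 takes paths from their owners; only the move at level 0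
   claims new ones. *)
Lemma move_edges own lev j : valid own -> ladder own lev j.+2 ->
  edges (move j.+1 lev own) = edges own.
Proof.
move=> ok lad; rewrite edges_move //; apply/setUidPl/subsetP => s.
rewrite !inE => /orP[] /(move_owner_request (ltnSn _) lad (ltn0Sn _)).
  by move->; rewrite orbT.
by rewrite farK => ->.
Qed.

Lemma move_ladder own lev j : valid own -> ladder own lev j.+2 ->
  ladder (move j.+1 lev own) lev j.+1.
Proof.
move=> ok lad s r Es rj; have [ss] := lad s r Es (ltnW rj).
case: r => [|r] in Es rj *.
  move=> fs; split=> //; move/setP/(_ s): (move_edges ok lad).
  by rewrite !inE /free -!negb_or => ->; rewrite negb_or.
case=> ofs tgt; split=> //; split=> //; case: ok => own_cls own_far own_uniq.
rewrite /move own_cls // farK /= ofs ifF; last first.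
  by apply/negP => /request_nown; rewrite ofs.
apply/negP => /andP[_]; rewrite Es => /eqP[rE].
by rewrite rE ltnn in rj.
Qed.

Lemma move_targeted own lev j : valid own -> ladder own lev j.+2 ->
  targeted own lev j.+2 -> targeted (move j.+1 lev own) lev j.+1.
Proof.
move=> ok lad tgt s sk; have ss : s \in cls s by case/andP: sk.
have [sk0|] := boolP (sink own s).
  have [t ts [r Et]] := tgt s sk0; rewrite ltnS leq_eqVlt => /predU1P[rE|]; last first.
    by exists t => //; exists r.
  have rt : request own j.+1 lev t.
    by rewrite /request Et rE eqxx /sink (cls_self ts) (has_owner_cls _ ts) andbT;
       case/andP: sk0.
  have := sink_nown sk ts; rewrite /move rt (cls_self ts) /=.
  by rewrite (negPf (request_far ok (ltnSn _) lad (ltn0Sn _) rt)).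
rewrite /sink ss negbK => /existsP[t /andP[ts ot]].
have := sink_nown sk ts; rewrite /move (cls_self ts) ot /= ifF; last first.
  by apply/negP => /request_nown; rewrite ot.
rewrite negbK => /andP[_ /eqP/lad/(_ (ltnSn _))[_ [_]]].
rewrite farK (cls_eq ts) => -[u us [r Eu rj]].
by exists u => //; exists r.
Qed.

Lemma moves_halve own lev j : valid own -> single lev ->
  ladder own lev j.+1 -> targeted own lev j.+1 ->
  valid (moves lev j own) /\ 2 * #|sinks (moves lev j own)| <= #|sinks own|.
Proof.
move=> + lev1; elim: j own => [|j IH] own ok lad tgt /=; last first.
  have ok' := move_valid j.+1 ok lev1.
  have [] := IH _ ok' (move_ladder ok lad) (move_targeted ok lad tgt).
  split=> //; suff -> : #|sinks own| = #|sinks (move j.+1 lev own)| by [].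
  have := card_edges ok'; rewrite move_edges // card_edges // => /eqP.
  rewrite eqn_mul2l /= => /eqP ownE; have := card_sinks ok'.
  by rewrite -ownE -(card_sinks ok) => /addIn.
have ok' := move_valid 0 ok lev1; split=> //.
pose F := [set s | request own 0 lev s].
have sinksF : #|sinks own| <= 3 * #|F|.
  rewrite -card_bigcup_cls; first last.
  - move=> s t; rewrite !inE => /andP[_ /eqP ls] /andP[_ /eqP lt].
    by apply: lev1; rewrite ?ls ?lt.
  - by move=> s; rewrite inE => /request_sink/andP[].
  apply/subset_leq_card/subsetP => s; rewrite inE => sk.
  have [t ts [r Et]] := tgt s sk; rewrite ltnS leqn0 => /eqP r0.
  have ss : s \in cls s by case/andP: sk.
  apply/bigcupP; exists t; last exact: cls_sym.
  rewrite inE /request Et r0 eqxx /sink (cls_self ts) (has_owner_cls _ ts) andbT.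
  by case/andP: sk.
have edgesF : #|edges own| + #|F| <= #|edges (move 0 lev own)|.
  rewrite -cardsUI (_ : _ :&: _ = set0) ?cards0 ?addn0.
    rewrite edges_move //; apply/subset_leq_card/setUS/subsetP => s.
    by rewrite !inE => ->.
  apply/setP=> s; rewrite !inE; apply/negP => /andP[os].
  case/andP=> _ /eqP/lad/(_ (ltnSn _))[_]; rewrite /free -negb_or.
  by rewrite os.
rewrite !card_edges // in edgesF.
have := card_sinks ok'; rewrite -(card_sinks ok) => cE.
rewrite -(leq_add2r (2 * (3 * #|[set s | move 0 lev own s]|))) -mulnDr cE.
rewrite mulnDr mul2n -addnn -addnA leq_add2l mulnCA [2 * (3 * _)]mulnCA.
by apply: leq_trans (leq_mul (leqnn 3) edgesF); rewrite mulnDr addnC leq_add2l.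
Qed.

Lemma phase_halves D own : valid own -> #|S| < 2 ^ D ->
  valid (phase D own) /\ 2 * #|sinks (phase D own)| <= #|sinks own|.
Proof.
move=> ok SD; apply: moves_halve => //; first exact: levels_single.
  exact: levels_ladder.
move=> s /(sink_labelled ok SD) /existsP[t /andP[ts lt]]; exists t => //.
case E: (levels own D t) lt => [r|] // _; exists r => //; exact: levels_le E.
Qed.

Lemma iter_phase_no_sink D K : #|S| < 2 ^ D -> #|S| < 2 ^ K ->
  let own := iter K (phase D) (fun=> false) in
  valid own /\ forall s, ~~ sink own s.
Proof.
move=> SD SK /=.
have [ok le] : valid (iter K (phase D) (fun=> false)) /\
    2 ^ K * #|sinks (iter K (phase D) (fun=> false))| <= #|S|.
  elim: K {SK} => [|K [ok le]] /=; first by split=> //; rewrite mul1n max_card.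
  have [ok' le'] := phase_halves ok SD; split=> //.
  by apply: leq_trans le; rewrite expnSr -mulnA leq_mul2l le' orbT.
split=> // s; apply/negP => sk.
have : 0 < #|sinks (iter K (phase D) (fun=> false))|.
  by apply/card_gt0P; exists s; rewrite inE.
move=> c0; have := leq_ltn_trans le SK; rewrite -{2}[2 ^ K]muln1.
by rewrite ltn_mul2l [_ < 1]ltnNge c0 andbF.
Qed.

End Phase.

(** * Path decompositions and their merging *)

Section Paths.

Variables (S : eqType) (rev : S -> S).
Implicit Types (mate : S -> S) (dir : S -> bool) (s : S).

(* Darts matched by [mate] are consecutive in a path; its fixed points are path ends. *)
Definition terminal mate s := mate s == s.

Definition back mate s := if mate s == s then s else rev (mate s).

Definition source mate L s := iter L (back mate) s.

Definition far mate L s := if mate s == s then source mate L (rev s) else s.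

(* L bounds the number of inner vertices of a path. *)
Definition path_system mate dir L :=
  [/\ involutive mate, forall s, dir (rev s) = ~~ dir s,
      forall s, mate s != s -> dir (mate s) = ~~ dir s
    & forall s, terminal mate (source mate L s)].

Hypothesis revK : involutive rev.

Lemma source_terminal mate k s : terminal mate s -> source mate k s = s.
Proof.
by move=> ts; rewrite /source; elim: k => //= k ->; rewrite /back ifT.
Qed.

Section PathSystem.

Variables (mate : S -> S) (dir : S -> bool) (L : nat).
Hypothesis ps : path_system mate dir L.

Lemma source_back k s : source mate (L + k) s = source mate L s.
Proof.
by case: ps => _ _ _ tL; rewrite addnC /source iterD -/(source _ L s)
  -/(source _ k _) source_terminal.
Qed.

Lemma source_step s : source mate L (back mate s) = source mate L s.
Proof. by rewrite -[RHS](source_back 1) addn1 /source iterSr. Qed.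

Lemma source_mate s : mate s != s -> source mate L (mate s) = source mate L (rev s).
Proof.
case: ps => mateK _ _ _ ms.
by rewrite -source_step /back mateK eq_sym (negPf ms).
Qed.

Lemma source_rev_mate s :
  mate s != s -> source mate L (rev (mate s)) = source mate L s.
Proof. by move=> ms; rewrite -[RHS]source_step /back (negPf ms). Qed.

Lemma source_rev_back s :
  source mate L (rev (back mate s)) = source mate L (rev s).
Proof.
by rewrite /back; case: eqP => // /eqP ms; rewrite revK source_mate.
Qed.

Lemma source_rev_source k s :
  source mate L (rev (source mate k s)) = source mate L (rev s).
Proof. by elim: k => //= k <-; rewrite source_rev_back. Qed.

Lemma farK : involutive (far mate L).
Proof.
case: ps => _ _ _ tL s; rewrite {2}/far; case: ifP => ts; last by rewrite /far ts.
rewrite /far ifT; last exact: tL.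
by rewrite source_rev_source revK source_terminal.
Qed.

Lemma dir_source k s : dir (source mate k s) = dir s.
Proof.
case: ps => _ dirV dirm _; elim: k => //= k <-; rewrite /back.
by case: eqP => // /eqP ms; rewrite dirV dirm // negbK.
Qed.

Lemma dir_far s : terminal mate s -> dir (far mate L s) = ~~ dir s.
Proof. by case: ps => _ dirV _ _ ts; rewrite /far ifT // dir_source dirV. Qed.

Variables (own : S -> bool) (pair : S -> S) (flip : S -> bool).

Definition merged s := if own s then pair s else mate s.

Definition redirected s :=
  dir s (+) (flip (source mate L s) || flip (source mate L (rev s))).

Hypothesis own_terminal : forall s, own s -> terminal mate s.
Hypothesis own_far : forall s, own s -> ~~ own (far mate L s).
Hypothesis own_pair : forall s, own s -> own (pair s).
Hypothesis pairK : forall s, own s -> pair (pair s) = s.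
Hypothesis flip_own : forall s, flip s -> own s.
Hypothesis flip_pair : forall s, own s -> pair s != s ->
  flip s (+) flip (pair s) = (dir s == dir (pair s)).

Lemma mergedK : involutive merged.
Proof.
case: ps => mateK _ _ _ s; rewrite {2}/merged; case: ifPn => os.
  by rewrite /merged own_pair // pairK.
rewrite /merged; case: ifPn => [om|]; last by rewrite mateK.
have /eqP := own_terminal om; rewrite mateK => /esym mE.
by rewrite mE (negPf os) in om.
Qed.

Lemma merged_terminal s : terminal mate s -> ~~ own s -> terminal merged s.
Proof. by rewrite /terminal /merged => ts /negPf->. Qed.

Lemma back_merged s : ~~ terminal mate s -> back merged s = back mate s.
Proof.
by move=> nts; rewrite /back /merged (negPf (contra (@own_terminal s) nts)).
Qed.

Lemma source_prefix k s : terminal mate (source mate k s) ->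
  exists2 j, j <= k & source merged j s = source mate k s.
Proof.
elim: k s => [|k IH] s; first by exists 0.
have [ts _|nts] := boolP (terminal mate s).
  by exists 0; rewrite // (source_terminal _ ts).
rewrite /source iterSr => /IH[j jk E]; exists j.+1 => //.
by rewrite iterSr back_merged.
Qed.

Lemma terminal_source_le mate' j k s : j <= k ->
  terminal mate' (source mate' j s) -> terminal mate' (source mate' k s).
Proof.
move=> /subnK <-; rewrite {2}/source iterD -/(source _ j s) -/(source _ _ _).
by move=> ts; rewrite source_terminal.
Qed.

(* Beyond a newly merged end lies one old path, whose other end is not owned,
   hence still terminal. *)
Lemma merged_source s : terminal merged (source merged L.*2.+1 s).
Proof.
case: ps => _ _ _ tL; have [j jL E] := source_prefix (tL s).
set d := source mate L s in E; have td : terminal mate d := tL s.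
have [od|nod] := boolP (own d); last first.
  apply: (@terminal_source_le _ j); last by rewrite E merged_terminal.
  by rewrite -addnn -addnS (leq_trans jL) ?leq_addr.
have [pd|npd] := eqVneq (pair d) d.
  apply: (@terminal_source_le _ j); last by rewrite E /terminal /merged od pd.
  by rewrite -addnn -addnS (leq_trans jL) ?leq_addr.
pose d' := rev (pair d); have [i iL E'] := source_prefix (tL d').
apply: (@terminal_source_le _ (i + (1 + j))).
  by rewrite -addnn -addSn addnC leq_add.
have bd : back merged d = d' by rewrite /back /merged od (negPf npd).
rewrite /source !iterD -/(source _ j s) E /= bd -/(source merged i d') E'.
rewrite merged_terminal //.
have -> : source mate L d' = far mate L (pair d).
  by rewrite /far ifT //; apply/own_terminal/own_pair.
exact/own_far/own_pair.
Qed.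

Lemma redirected_rev s : redirected (rev s) = ~~ redirected s.
Proof. by case: ps => _ dirV _ _; rewrite /redirected dirV revK orbC addNb. Qed.

Lemma redirected_merged s : merged s != s -> redirected (merged s) = ~~ redirected s.
Proof.
case: ps => mateK dirV dirm tL; rewrite /merged; case: ifPn => os ms.
  have flipE t : own t -> flip (source mate L t) || flip (source mate L (rev t)) = flip t.
    move=> ot; have tt := own_terminal ot; rewrite source_terminal //.
    have := own_far ot; rewrite /far ifT // => nof.
    by rewrite [flip (source _ _ _)](negPf (contra (@flip_own _) nof)) orbF.
  rewrite /redirected !flipE ?own_pair //; have := flip_pair os ms.
  by case: (flip s); case: (flip _); case: (dir s); case: (dir _).
rewrite /redirected dirm // addNb; congr (~~ (_ (+) _)).
by rewrite source_rev_mate // source_mate // orbC.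
Qed.

Lemma merged_path_system : path_system merged redirected L.*2.+1.
Proof.
split; [exact: mergedK | exact: redirected_rev | exact: redirected_merged |].
exact: merged_source.
Qed.

End PathSystem.

End Paths.

(** * The distributed algorithm *)

Inductive instruction := Seed | Bfs of nat | Move of nat | Merge.

(* The instruction of an entry (k, i) is executed after k.+1 rounds, during which a bit
   travels between the two ends of each path. *)
Definition program := seq (nat * instruction).

Record memory := Memory {
  outward : nat -> bool;
  (* fixed at the ports where a path ends *)
  partner : nat -> nat;
  owns : nat -> bool;
  level : nat -> option nat
}.

Definition ends d (mt : nat -> nat) := [seq p <- iota 0 d | mt p == p].
Definition group d mt p := triple (ends d mt) p.
Definition owned d (ow : nat -> bool) := [seq p <- iota 0 d | ow p].

Definition emit d i m p :=
  match i with
  | Seed => owns m p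
  | Bfs _ => owns m p && has (level m) (group d (partner m) p)
  | Move j => [&& p \in group d (partner m) p,
                 ~~ has (owns m) (group d (partner m) p) & level m p == Some j]
  | Merge => let l := owned d (owns m) in
      [&& owns m p, odd (index p l) & outward m p == outward m (adjacent l p)]
  end.

(* [buf] holds the bit last received at each port: inner vertices of a path relay it. *)
Definition outgoing d i m (buf : nat -> bool) p :=
  if partner m p == p then emit d i m p else buf (partner m p).

Definition first_in_group d mt (P : pred nat) p :=
  [&& p \in group d mt p, P p & all (fun q => P q ==> (p <= q)) (group d mt p)].

Definition execute d i m (buf : nat -> bool) :=
  let: Memory dr mt ow lv := m in
  match i with
  | Seed =>
      Memory dr mt ow (fun p =>
        if first_in_group d mt (fun q => ~~ ow q && ~~ buf q) p then Some 0 else None)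
  | Bfs j =>
      Memory dr mt ow (fun p =>
        if has lv (group d mt p) then lv p
        else if first_in_group d mt buf p then Some j else None)
  | Move j =>
      Memory dr mt (fun p => (p \in group d mt p) &&
        (if emit d i m p then buf p ==> dr p else ow p && ~~ buf p)) lv
  (* The flip requests of both ends of a path have passed through all its vertices. *)
  | Merge =>
      Memory (fun p => dr p (+) (outgoing d i m buf p || buf p))
        (fun p => if ow p then adjacent (owned d ow) p else mt p)
        (fun=> false) lv
  end.

Inductive vertex_state :=
  | Start of nat & nat & nat & program
  | Work of nat & memory & (nat -> bool) & program.

Definition send_message st p :=
  match st with
  | Start w x _ _ => bits w x
  | Work d m buf prg =>
      [:: if prg is (_, i) :: _ then outgoing d i m buf p else false]
  end.

Definition receive_messages st (msgs : seq (seq bool)) :=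
  match st with
  | Start w x d prg =>
      Work d (Memory (fun p => value (nth [::] msgs p) < x) id (fun=> false) (fun=> None))
        (fun=> false) prg
  | Work d m buf [::] => st
  | Work d m buf ((k, i) :: prg) =>
      let buf' p := nth false (nth [::] msgs p) 0 in
      if k is k'.+1 then Work d m buf' ((k', i) :: prg)
      else Work d (execute d i m buf') buf' prg
  end.

Definition phase_program D :=
  Seed :: [seq Bfs j.+1 | j <- iota 0 D] ++ rev [seq Move j | j <- iota 0 D.+1].

Definition stage_program D (L : nat) : program :=
  [seq (L, i) | i <- flatten (nseq D (phase_program D))] ++ [:: (L, Merge)].

Fixpoint full_program D L I :=
  if I is I'.+1 then stage_program D L ++ full_program D L.*2.+1 I' else [::].

Definition duration (prg : program) := sumn [seq x.1.+1 | x <- prg].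

Definition vertex_program I n := full_program (2 * up_log 2 n).+1 0 I.

Definition splitting (c I : nat) : algorithm := {|
  state := vertex_state;
  init n x d := Start (c * up_log 2 n).+1 x d (vertex_program I n);
  send := send_message;
  receive := receive_messages;
  rounds n := if n <= 1 then 0 else (duration (vertex_program I n)).+1;
  output st p := if st is Work _ m _ _ then outward m p else false
|}.

Section Simulation.

Variables (c I : nat) (V : finType) (e : rel V) (ident : V -> nat) (port : V -> seq V).
Hypothesis e_simple : simple_graph e.
Hypothesis ids : unique_ids c ident.
Hypothesis ports : port_numbering e port.

Definition dart := {d : V * V | e d.1 d.2}.
Implicit Types s t : dart.

Definition tail s := (val s).1.
Definition head s := (val s).2.
Definition number s := index (head s) (port (tail s)).
Local Notation degree v := (size (port v)).

Lemma edge_sym u v : e u v = e v u. Proof. by case: e_simple => + _; apply. Qed.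

Definition reverse s : dart :=
  exist _ (head s, tail s) (etrans (edge_sym _ _) (valP s)).

Lemma reverseK : involutive reverse.
Proof. by move=> s; apply: val_inj; case: s => -[]. Qed.

Lemma head_port s : head s \in port (tail s).
Proof. by case: (ports (tail s)) => _ ->; apply: (valP s). Qed.

Lemma number_lt s : number s < degree (tail s).
Proof. by rewrite index_mem head_port. Qed.

Lemma nth_number x s : nth x (port (tail s)) (number s) = head s.
Proof. by rewrite nth_index ?head_port. Qed.

Lemma dart_inj s t : tail s = tail t -> number s = number t -> s = t.
Proof.
move=> tl nb; apply: val_inj; rewrite [val s]surjective_pairing [val t]surjective_pairing.
congr (_, _); first exact: tl.
by rewrite -/(head s) -/(head t) -(nth_number (head s) s) nb tl nth_number.
Qed.

Definition at_port s p : dart := insubd s (tail s, nth (head s) (port (tail s)) p).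

Lemma val_at_port s p : p < degree (tail s) ->
  val (at_port s p) = (tail s, nth (head s) (port (tail s)) p).
Proof.
move=> pd; rewrite val_insubd ifT //=; case: (ports (tail s)) => _ portE.
by rewrite -[e _ _]/(_ \in e (tail s)) -portE mem_nth.
Qed.

Lemma tail_at s p : p < degree (tail s) -> tail (at_port s p) = tail s.
Proof. by move=> pd; rewrite /tail val_at_port. Qed.

Lemma number_at s p : p < degree (tail s) -> number (at_port s p) = p.
Proof.
move=> pd; rewrite /number /head tail_at // val_at_port //= index_uniq //.
by case: (ports (tail s)).
Qed.

Lemma at_number s : at_port s (number s) = s.
Proof. by apply: dart_inj; rewrite ?tail_at ?number_at ?number_lt. Qed.

Lemma card_darts v (P : pred nat) :
  #|[set s | (tail s == v) && P (number s)]| = count P (iota 0 (degree v)).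
Proof.
have head_inj : {in [set s | (tail s == v) && P (number s)] &, injective head}.
  move=> s t; rewrite !inE => /andP[/eqP sv _] /andP[/eqP tv _] hd.
  by apply: val_inj; rewrite [val s]surjective_pairing [val t]surjective_pairing
     -/(tail s) -/(tail t) sv tv -/(head s) hd.
case: (ports v) => uv vE; rewrite -(card_in_imset head_inj) -(count_index P uv).
rewrite -size_filter -(card_uniqP (filter_uniq _ uv)); apply: eq_card => u.
rewrite mem_filter; apply/imsetP/andP => [[s]|[Pu uP]].
  rewrite inE => /andP[/eqP sv Ps] ->; rewrite -sv; split=> //; exact: head_port.
have evu : e v u by rewrite -[e v u]/(u \in e v) -vE.
by exists (exist _ (v, u) evu) => //; rewrite inE /number /tail /head /= eqxx.
Qed.

Lemma port_dart v p : p < degree v -> exists2 s, tail s = v & number s = p.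
Proof.
move=> pd; case: (ports v) => uv portE.
have evu : e v (nth v (port v) p) by rewrite -[e _ _]/(_ \in e v) -portE mem_nth.
exists (exist _ (v, nth v (port v) p) evu) => //.
by rewrite /number /head /tail /= index_uniq.
Qed.

Definition mate (mt : V -> nat -> nat) s := at_port s (mt (tail s) (number s)).

Definition port_map (mt : V -> nat -> nat) :=
  forall v p, p < degree v -> mt v p < degree v.

Lemma tail_mate mt s : port_map mt -> tail (mate mt s) = tail s.
Proof. by move=> wf; rewrite tail_at ?wf ?number_lt. Qed.

Lemma number_mate mt s : port_map mt -> number (mate mt s) = mt (tail s) (number s).
Proof. by move=> wf; rewrite number_at ?wf ?number_lt. Qed.

Lemma mate_eq mt s :
  port_map mt -> (mate mt s == s) = (mt (tail s) (number s) == number s).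
Proof.
move=> wf; apply/eqP/eqP => [E|E]; first by rewrite -[in RHS]E number_mate.
by rewrite /mate E at_number.
Qed.

Definition cls mt s :=
  [set t | (tail t == tail s) &&
           (number t \in group (degree (tail s)) (mt (tail s)) (number s))].

Lemma uniq_ends d mt : uniq (ends d mt). Proof. exact/filter_uniq/iota_uniq. Qed.

Lemma group_ends d mt p q : q \in group d mt p -> (q < d) && (mt q == q).
Proof. by rewrite !mem_filter mem_iota add0n /= => /and3P[_ -> ->]. Qed.

Lemma cls_self_group mt s :
  (s \in cls mt s) = (number s \in group (degree (tail s)) (mt (tail s)) (number s)).
Proof. by rewrite inE eqxx. Qed.

Lemma cls_eq_group mt s t : t \in cls mt s -> cls mt t = cls mt s.
Proof.
rewrite inE => /andP[/eqP ts tg]; apply/setP=> u.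
by rewrite !inE ts; congr (_ && (_ \in _)); apply: triple_eq.
Qed.

Lemma card_cls_group mt s : s \in cls mt s -> #|cls mt s| = 3.
Proof.
rewrite cls_self_group => sg; rewrite card_darts -(size_triple (uniq_ends _ _) sg).
rewrite -size_filter; apply/perm_size/uniq_perm.
- exact/filter_uniq/iota_uniq.
- exact/filter_uniq/uniq_ends.
move=> p; rewrite mem_filter mem_iota add0n /=.
by apply: andb_idr => /group_ends/andP[].
Qed.

Lemma has_group mt s (P : pred nat) (Q : pred dart) :
  (forall t, t \in cls mt s -> P (number t) = Q t) ->
  has P (group (degree (tail s)) (mt (tail s)) (number s)) = [exists t in cls mt s, Q t].
Proof.
move=> PQ; apply/hasP/existsP => [[p pg Pp]|[t /andP[tc Qt]]]; last first.
  by exists (number t); [move: tc; rewrite inE => /andP[] | rewrite PQ].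
have /andP[pd _] := group_ends pg; have tc : at_port s p \in cls mt s.
  by rewrite inE tail_at // eqxx number_at.
by exists (at_port s p); rewrite tc -PQ // number_at.
Qed.

Lemma all_group mt s (P : pred nat) (Q : pred dart) :
  (forall t, t \in cls mt s -> P (number t) = Q t) ->
  all P (group (degree (tail s)) (mt (tail s)) (number s)) = [forall t in cls mt s, Q t].
Proof.
move=> PQ; apply: negb_inj; rewrite -has_predC negb_forall.
rewrite (has_group (Q := predC Q)); first by apply: eq_existsb => t; rewrite negb_imply.
by move=> t /PQ /= ->.
Qed.

Lemma first_in_groupE mt s (P : pred nat) (Q : pred dart) :
  (forall t, t \in cls mt s -> P (number t) = Q t) ->
  first_in_group (degree (tail s)) (mt (tail s)) P (number s) =
  chosen (cls mt) number Q s.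
Proof.
move=> PQ; rewrite /first_in_group /chosen -cls_self_group; apply: andb_id2l => ss.
rewrite PQ //; congr (_ && _).
by apply: (all_group (Q := fun t => Q t ==> (number s <= number t))) => t /PQ ->.
Qed.

Lemma cls_terminal mt s t : port_map mt -> t \in cls mt s -> terminal (mate mt) t.
Proof.
move=> wf; rewrite inE /terminal mate_eq // => /andP[/eqP-> /group_ends/andP[_]].
by [].
Qed.

Local Notation run := (run (splitting c I) ident port).

Definition signal i (M : V -> memory) s :=
  emit (degree (tail s)) i (M (tail s)) (number s).
Definition sent i (M : V -> memory) (b : V -> nat -> bool) s :=
  outgoing (degree (tail s)) i (M (tail s)) (b (tail s)) (number s).
Definition partners (M : V -> memory) v := partner (M v).

Lemma round_step T M b k i prg :
  (forall v, run T v = Work (degree v) (M v) (b v) ((k, i) :: prg)) ->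
  exists2 b' : V -> nat -> bool,
    forall v, run T.+1 v =
      if k is k'.+1 then Work (degree v) (M v) (b' v) ((k', i) :: prg)
      else Work (degree v) (execute (degree v) i (M v) (b' v)) (b' v) prg
  & forall s, b' (tail s) (number s) = sent i M b (reverse s).
Proof.
move=> runT.
exists (fun v p => nth false (nth [::]
  [seq send_message (run T u) (index v (port u)) | u <- port v] p) 0).
  by move=> v; rewrite /= runT; case: k {runT}.
move=> s; rewrite (nth_map (head s)) ?number_lt // nth_number /=.
by rewrite runT.
Qed.

Definition relayed r i M b := forall s,
  terminal (mate (partners M)) (source reverse (mate (partners M)) r s) ->
  sent i M b s = signal i M (source reverse (mate (partners M)) r s).

Lemma relayed_step r i M b b' : port_map (partners M) -> relayed r i M b ->
  (forall s, b' (tail s) (number s) = sent i M b (reverse s)) -> relayed r.+1 i M b'.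
Proof.
move=> wf rel b'E s; have [ts _|nts] := boolP (terminal (mate (partners M)) s).
  rewrite source_terminal //; move: ts; rewrite /terminal mate_eq // => ts.
  by rewrite /sent /outgoing ifT.
rewrite /source iterSr.
have -> : back reverse (mate (partners M)) s = reverse (mate (partners M) s).
  by rewrite /back ifN.
move/rel <-; rewrite -b'E tail_mate // number_mate // /sent /outgoing ifN //.
by rewrite -[partner _ _]/(partners M _ _) -mate_eq.
Qed.

Lemma relay k i prg M : port_map (partners M) -> forall T r b,
  (forall v, run T v = Work (degree v) (M v) (b v) ((k, i) :: prg)) ->
  relayed r i M b ->
  exists b', [/\ forall v, run (T + k.+1) v =
      Work (degree v) (execute (degree v) i (M v) (b' v)) (b' v) prg,
    relayed (r + k).+1 i M b'
  & forall s, terminal (mate (partners M))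
        (source reverse (mate (partners M)) (r + k) (reverse s)) ->
      b' (tail s) (number s) =
      signal i M (source reverse (mate (partners M)) (r + k) (reverse s))].
Proof.
move=> wf; elim: k => [|k IH] T r b runT rel;
    have [b' run' b'E] := round_step runT; last first.
  have [b'' [run'' rel'' b''E]] := IH _ r.+1 b' run' (relayed_step wf rel b'E).
  by exists b''; rewrite -(addSnnS T) -(addSnnS r).
exists b'; rewrite addn1 addn0; split=> //; first exact: relayed_step rel b'E.
by move=> s ts; rewrite b'E rel.
Qed.

(* [o] and [l] are the fields [owns] and [level] read at all darts. *)
Definition configuration T (mt : V -> nat -> nat) (dr : V -> nat -> bool)
    (o : dart -> bool) (l : dart -> option nat) prg :=
  exists b ow lv, [/\ forall v, run T v =
      Work (degree v) (Memory (dr v) (mt v) (ow v) (lv v)) (b v) prg,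
    forall s, ow (tail s) (number s) = o s
  & forall s, lv (tail s) (number s) = l s].

Definition direction (dr : V -> nat -> bool) s := dr (tail s) (number s).

Definition global_execute mt dr L (ol : (dart -> bool) * (dart -> option nat)) i :
    (dart -> bool) * (dart -> option nat) :=
  let: (o, l) := ol in let f := far reverse (mate mt) L in
  match i with
  | Seed => (o, seed (cls mt) f number o)
  | Bfs j => (o, bfs (cls mt) f number o j l)
  | Move j => (move (cls mt) f (direction dr) j l o, l)
  | Merge => (o, l)
  end.

Definition system mt dr L :=
  port_map mt /\ path_system reverse (mate mt) (direction dr) L.

Lemma exchange T mt dr o l L i prg : system mt dr L ->
  configuration T mt dr o l ((L, i) :: prg) ->
  exists ow lv b, let M v := Memory (dr v) (mt v) (ow v) (lv v) in
  [/\ forall v, run (T + L.+1) v =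
        Work (degree v) (execute (degree v) i (M v) (b v)) (b v) prg,
    forall s, ow (tail s) (number s) = o s,
    forall s, lv (tail s) (number s) = l s,
    forall s, sent i M b s = signal i M (source reverse (mate mt) L s)
  & forall s, b (tail s) (number s) =
        signal i M (source reverse (mate mt) L (reverse s))].
Proof.
case=> wf ps [b [ow [lv [runT owE lvE]]]].
have [||b' [run' rel b'E]] :=
  @relay L i prg (fun v => Memory (dr v) (mt v) (ow v) (lv v)) wf T 0 b.
- exact: runT.
- by move=> s; rewrite /terminal /= mate_eq // /sent /outgoing /= => ->.
have tL : forall s, terminal (mate mt) (source reverse (mate mt) L s) by case: ps.
exists ow, lv, b'; split=> // s; last by rewrite b'E.
have sL : source reverse (mate mt) L.+1 s = source reverse (mate mt) L s.
  by rewrite -addn1 (source_back ps).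
by move: (rel s); rewrite add0n -[partners _]/mt sL; apply.
Qed.

Lemma execute_configuration T mt dr o l L i prg : system mt dr L -> i <> Merge ->
  configuration T mt dr o l ((L, i) :: prg) ->
  configuration (T + L.+1) mt dr (global_execute mt dr L (o, l) i).1
    (global_execute mt dr L (o, l) i).2 prg.
Proof.
move=> sys iM /(exchange sys)[ow [lv [b [runT owE lvE sE bE]]]].
have [wf ps] := sys; pose f := far reverse (mate mt) L.
pose M v := Memory (dr v) (mt v) (ow v) (lv v).
have bf s t : t \in cls mt s -> b (tail s) (number t) = signal i M (f t).
  move=> ts; have tt := cls_terminal wf ts; move: ts; rewrite inE => /andP[/eqP<- _].
  by rewrite bE /f /far ifT.
have owt s t : t \in cls mt s -> ow (tail s) (number t) = o t.
  by rewrite inE => /andP[/eqP<- _].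
have lvt s t : t \in cls mt s -> lv (tail s) (number t) = l t.
  by rewrite inE => /andP[/eqP<- _].
have lab s : has (lv (tail s)) (group (degree (tail s)) (mt (tail s)) (number s)) =
             labelled (cls mt) l s.
  by apply: has_group => t /lvt ->.
have own s : has (ow (tail s)) (group (degree (tail s)) (mt (tail s)) (number s)) =
             has_owner (cls mt) o s.
  by apply: has_group => t /owt ->.
case: i iM runT bf {sE bE} => [|j|j|] // _ runT bf.
- exists b, ow, (fun v => level (execute (degree v) Seed (M v) (b v))).
  split; [exact: runT | exact: owE | move=> s /=].
  rewrite (first_in_groupE (Q := free f o)) // => t ts.
  by rewrite (owt _ _ ts) (bf _ _ ts) /signal /= owE.
- exists b, ow, (fun v => level (execute (degree v) (Bfs j) (M v) (b v))).
  split; [exact: runT | exact: owE | move=> s /=].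
  rewrite /bfs lab lvE (first_in_groupE (Q := heard (cls mt) f o l)) // => t ts.
  by rewrite (bf _ _ ts) /signal /= owE lab.
have sigE s : emit (degree (tail s)) (Move j) (M (tail s)) (number s) =
              request (cls mt) o j l s.
  by rewrite /= lvE own -cls_self_group andbA.
exists b, (fun v => owns (execute (degree v) (Move j) (M v) (b v))), lv.
split; [exact: runT | move=> s | exact: lvE].
rewrite [LHS]/= -cls_self_group /move; apply: andb_id2l => ss.
by rewrite lvE own andbA owE (bf _ _ ss) /signal sigE.
Qed.

Lemma uniq_owned d ow : uniq (owned d ow). Proof. exact/filter_uniq/iota_uniq. Qed.

Lemma mem_owned d ow p : (p \in owned d ow) = ow p && (p < d).
Proof. by rewrite mem_filter mem_iota. Qed.

Lemma size_ends_card mt v : port_map mt ->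
  size (ends (degree v) (mt v)) = #|[set s | (tail s == v) && terminal (mate mt) s]|.
Proof.
move=> wf; rewrite size_filter -card_darts; apply: eq_card => s; rewrite !inE.
by apply: andb_id2l => /eqP<-; rewrite /terminal mate_eq.
Qed.

Lemma size_owned mt o ow v L :
  port_map mt -> valid (cls mt) (far reverse (mate mt) L) o ->
  (forall s, ow (tail s) (number s) = o s) -> (forall s, ~~ sink (cls mt) o s) ->
  size (owned (degree v) (ow v)) = size (ends (degree v) (mt v)) %/ 3.
Proof.
move=> wf [own_cls _ own_uniq] owE nosink.
set E := ends _ _; apply/eqP; rewrite -(eqn_pmul2l (isT : 0 < 3)); apply/eqP.
rewrite -(count_triple (uniq_ends _ _)) size_filter -card_darts.
have Xo s : s \in [set s | (tail s == v) && ow v (number s)] -> o s.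
  by rewrite inE => /andP[/eqP<-]; rewrite owE.
rewrite -(card_bigcup_cls (cls := cls mt)); first last.
- by move=> s t /Xo os /Xo ot; apply: own_uniq.
- by move=> s /Xo/own_cls.
- exact: card_cls_group.
- exact: cls_eq_group.
rewrite count_filter.
rewrite (eq_count (a2 := fun p => p \in group (degree v) (mt v) p)); last first.
  by move=> p; apply: andb_idr => /group_ends/andP[].
rewrite -card_darts; apply: eq_card => t; rewrite inE; apply/bigcupP/andP.
  case=> s; rewrite inE => /andP[/eqP sv _] ts.
  have := ts; rewrite inE sv => /andP[/eqP tv _].
  have := cls_eq_group ts; rewrite tv eqxx; split=> //.
  by rewrite -tv -cls_self_group (cls_eq_group ts).
case=> /eqP tv; rewrite -tv -cls_self_group => tt; have := nosink t.
rewrite /sink tt negbK => /existsP[s /andP[st os]]; exists s.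
  by have := st; rewrite !inE => /andP[/eqP<- _]; rewrite eqxx owE.
by rewrite (cls_eq_group st).
Qed.

Lemma size_ends_adjacent d mt (ow : nat -> bool) :
  (forall p, p < d -> ow p -> mt p = p) ->
  size (owned d ow) = size (ends d mt) %/ 3 ->
  size (ends d (fun p => if ow p then adjacent (owned d ow) p else mt p)) =
  size (ends d mt) - 2 * (size (ends d mt) %/ 6).
Proof.
move=> owmt szo; have c1 : size (ends d mt) =
    count (fun p => ~~ ow p && (mt p == p)) (iota 0 d) + size (owned d ow).
  rewrite !size_filter -count_predUI [X in _ + X](eq_count (a2 := pred0)).
    rewrite count_pred0 addn0; apply: eq_in_count => p; rewrite mem_iota => /= pd.
    by case op: (ow p); rewrite /= ?orbF // owmt ?eqxx.
  by move=> p /=; case: (ow p); rewrite ?andbF.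
have c2 : size (ends d (fun p => if ow p then adjacent (owned d ow) p else mt p)) =
    count (fun p => ~~ ow p && (mt p == p)) (iota 0 d) + odd (size (owned d ow)).
  rewrite -(count_adjacent (uniq_owned d ow)) count_filter size_filter -count_predUI.
  rewrite [X in _ + X](eq_count (a2 := pred0)); last first.
    by move=> p /=; case: (ow p); rewrite ?andbF.
  rewrite count_pred0 addn0; apply: eq_count => p /=.
  by case: (ow p); rewrite /= ?andbT ?andbF ?orbF.
rewrite c2 {1}c1 (divnMA _ 3 2) -szo divn2 mul2n.
by rewrite -{2}(odd_double_half (size (owned d ow))) addnA addnK.
Qed.

Lemma merge_configuration T mt dr o l L prg : system mt dr L ->
  valid (cls mt) (far reverse (mate mt) L) o -> (forall s, ~~ sink (cls mt) o s) ->
  configuration T mt dr o l ((L, Merge) :: prg) ->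
  exists mt' dr', [/\ system mt' dr' L.*2.+1,
    configuration (T + L.+1) mt' dr' (fun=> false) l prg
  & forall v, size (ends (degree v) (mt' v)) =
      size (ends (degree v) (mt v)) - 2 * (size (ends (degree v) (mt v)) %/ 6)].
Proof.
move=> sys ok nosink /(exchange sys)[ow [lv [b [runT owE lvE sE bE]]]].
have [wf ps] := sys; pose M v := Memory (dr v) (mt v) (ow v) (lv v).
have [own_cls own_far _] := ok; pose lo v := owned (degree v) (ow v).
pose pair s := at_port s (adjacent (lo (tail s)) (number s)).
have own_lo s : o s -> number s \in lo (tail s).
  by move=> os; rewrite mem_owned owE os number_lt.
have adj_lt s : o s -> adjacent (lo (tail s)) (number s) < degree (tail s).
  by move=> /own_lo/adjacent_mem; rewrite mem_owned => /andP[].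
have tail_pair s : o s -> tail (pair s) = tail s by move=> /adj_lt/tail_at.
have number_pair s : o s -> number (pair s) = adjacent (lo (tail s)) (number s).
  by move=> /adj_lt/number_at.
have own_pair s : o s -> o (pair s).
  move=> os; rewrite -owE tail_pair // number_pair //.
  by have := adjacent_mem (own_lo s os); rewrite mem_owned => /andP[].
pose mt' v p := if ow v p then adjacent (lo v) p else mt v p.
pose dr' v p := dr v p (+) (outgoing (degree v) Merge (M v) (b v) p || b v p).
have wf' : port_map mt'.
  move=> v p pd; rewrite /mt'; case: ifP => [op|_]; last exact: wf.
  have := @adjacent_mem _ (lo v) p; rewrite !mem_owned op pd => /(_ isT).
  by case/andP.
have mateE : mate mt' = merged (mate mt) o pair.
  apply: functional_extensionality => s; rewrite /mate /mt' owE /merged.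
  by case: ifP.
have dirE : direction dr' =
    redirected reverse (mate mt) (direction dr) L (signal Merge M).
  by apply: functional_extensionality => s; rewrite /redirected -sE -bE.
exists mt', dr'; split.
- split=> //; rewrite mateE dirE; apply: merged_path_system => //.
  + exact: reverseK.
  + by move=> s /own_cls/(cls_terminal wf).
  + move=> s os; have os' := own_pair s os.
    apply: dart_inj; first by rewrite !tail_pair.
    by rewrite number_pair // tail_pair // number_pair // adjacentK ?uniq_owned.
  + by move=> s; rewrite /signal /= owE => /and3P[].
  + move=> s os np; have os' := own_pair s os.
    have nadj : adjacent (lo (tail s)) (number s) != number s.
      by apply: contraNneq np => E; rewrite /pair E at_number.
    rewrite /signal /= !owE os os' /= tail_pair // number_pair // -/(lo _).
    rewrite adjacentK ?uniq_owned // odd_index_adjacent ?uniq_owned ?own_lo //.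
    rewrite /direction tail_pair // number_pair //.
    by case: (odd _) => /=; rewrite ?addbF // eq_sym.
- exists b, (fun _ _ => false), lv; split=> //.
move=> v; apply: (@size_ends_adjacent _ _ (ow v)); last first.
  exact: (size_owned v wf ok owE nosink).
move=> p /port_dart[s <- <-]; rewrite owE => /own_cls/(cls_terminal wf).
by rewrite /terminal mate_eq // => /eqP.
Qed.

Definition silent i := if i is Merge then false else true.

Lemma execute_program T mt dr ol L ins prg : system mt dr L -> all silent ins ->
  configuration T mt dr ol.1 ol.2 ([seq (L, i) | i <- ins] ++ prg) ->
  let ol' := foldl (global_execute mt dr L) ol ins in
  configuration (T + duration [seq (L, i) | i <- ins]) mt dr ol'.1 ol'.2 prg.
Proof.
move=> sys; elim: ins T ol => [|i ins IH] T ol /=; first by rewrite addn0.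
case/andP=> si sis; case: ol => o l /(execute_configuration sys) conf.
rewrite /duration /= addnA; apply: IH => //; apply: conf.
by case: i si.
Qed.

Lemma phase_program_silent D : all silent (phase_program D).
Proof.
rewrite /phase_program -cat1s !all_cat all_rev !all_map.
by apply/and3P; split=> //; apply/allP.
Qed.

Lemma iota_rcons n : iota 0 n.+1 = rcons (iota 0 n) n.
Proof. by rewrite -addn1 iotaD cats1. Qed.

Lemma foldl_phase mt dr L D o l :
  let f := far reverse (mate mt) L in
  foldl (global_execute mt dr L) (o, l) (phase_program D) =
  (phase (cls mt) f number (direction dr) D o, levels (cls mt) f number o D).
Proof.
move=> f; rewrite /phase_program -cat1s !foldl_cat.
have -> : foldl (global_execute mt dr L)
    (foldl (global_execute mt dr L) (o, l) [:: Seed])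
    [seq Bfs j.+1 | j <- iota 0 D] = (o, levels (cls mt) f number o D).
  elim: D => // D IH.
  by rewrite iota_rcons map_rcons -cats1 foldl_cat IH.
rewrite /phase; move: (levels _ _ _ _ _) => lev.
elim: D o => [|D IH] o //.
by rewrite iota_rcons map_rcons rev_rcons [LHS]/= IH.
Qed.

Lemma phases_programS K D : flatten (nseq K.+1 (phase_program D)) =
  phase_program D ++ flatten (nseq K (phase_program D)).
Proof. by []. Qed.

Lemma foldl_phases mt dr L D K o l :
  let f := far reverse (mate mt) L in
  (foldl (global_execute mt dr L) (o, l) (flatten (nseq K (phase_program D)))).1 =
  iter K (phase (cls mt) f number (direction dr) D) o.
Proof.
elim: K o l => // K IH o l.
by rewrite phases_programS foldl_cat foldl_phase IH -iterSr.
Qed.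

Lemma system_valid_phases mt dr L D : system mt dr L -> #|{: dart}| < 2 ^ D ->
  let f := far reverse (mate mt) L in
  let o := iter D (phase (cls mt) f number (direction dr) D) (fun=> false) in
  valid (cls mt) f o /\ forall s, ~~ sink (cls mt) o s.
Proof.
case=> wf ps cD; apply: iter_phase_no_sink => //.
- exact: cls_eq_group.
- exact: card_cls_group.
- by move=> s t; rewrite !inE => _ /andP[/eqP ts _]; apply: dart_inj.
- exact: (farK reverseK ps).
- by move=> s /(cls_terminal wf); apply: dir_far.
Qed.

Lemma stage_configuration T mt dr l D L prg : system mt dr L -> #|{: dart}| < 2 ^ D ->
  configuration T mt dr (fun=> false) l (stage_program D L ++ prg) ->
  exists mt' dr' l', [/\ system mt' dr' L.*2.+1,
    configuration (T + duration (stage_program D L)) mt' dr' (fun=> false) l' prg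
  & forall v, size (ends (degree v) (mt' v)) =
      size (ends (degree v) (mt v)) - 2 * (size (ends (degree v) (mt v)) %/ 6)].
Proof.
move=> sys cD; rewrite /stage_program -catA => conf.
have sil K : all silent (flatten (nseq K (phase_program D))).
  by elim: K => // K IH; rewrite phases_programS all_cat phase_program_silent.
have := @execute_program T mt dr (fun=> false, l) L _ _ sys (sil D) conf.
set ol := foldl _ _ _ => /= conf'; have oE : ol.1 = _ := foldl_phases _ _ _ _ _ _ _.
have [||mt' [dr' [sys' conf'' ends']]] := merge_configuration sys _ _ conf'.
- by rewrite oE; case: (system_valid_phases sys cD).
- by rewrite oE; case: (system_valid_phases sys cD).
exists mt', dr', ol.2; split=> //.
by rewrite /duration map_cat sumn_cat /= addn0 addnA.
Qed.

Lemma full_configuration T mt dr l D L J : system mt dr L -> #|{: dart}| < 2 ^ D ->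
  configuration T mt dr (fun=> false) l (full_program D L J) ->
  exists mt' dr' o' l' L', [/\ system mt' dr' L',
    configuration (T + duration (full_program D L J)) mt' dr' o' l' [::]
  & forall v, 3 ^ J * size (ends (degree v) (mt' v)) + 2 ^ J * 5 <=
      2 ^ J * size (ends (degree v) (mt v)) + 3 ^ J * 5].
Proof.
move=> + cD; elim: J T mt dr l L => [|J IH] T mt dr l L sys conf.
  by exists mt, dr, (fun=> false), l, L; rewrite addn0.
have [mt1 [dr1 [l1 [sys1 conf1 ends1]]]] := stage_configuration sys cD conf.
have [mt2 [dr2 [o2 [l2 [L2 [sys2 conf2 ends2]]]]]] := IH _ _ _ _ _ sys1 conf1.
exists mt2, dr2, o2, l2, L2; split=> //.
  by rewrite /duration map_cat sumn_cat addnA.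
move=> v; have := ends2 v; rewrite {}ends1 !expnS.
move: (size _) (size _) (2 ^ J) (3 ^ J) => E2 E A B.
have : A * (3 * (E - 2 * (E %/ 6))) <= A * (2 * E + 5) by rewrite leq_mul2l; lia.
nia.
Qed.

Lemma card_dart : #|{: dart}| < 2 ^ (2 * up_log 2 #|V|).+1.
Proof.
apply: (@leq_ltn_trans (#|V| ^ 2)).
  rewrite expnS expn1 -card_prod.
  exact: (leq_card (val : dart -> V * V) val_inj).
apply: (@leq_ltn_trans ((2 ^ up_log 2 #|V|) ^ 2)).
  by rewrite leq_exp2r // up_logP.
by rewrite -expnM mulnC ltn_exp2l.
Qed.

Lemma head_tail s : head s != tail s.
Proof.
case: e_simple => _ irr; apply/eqP => hd; have := valP s.
by rewrite -/(head s) -/(tail s) hd irr.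
Qed.

Lemma initial_configuration : exists mt dr l,
  [/\ system mt dr 0,
    configuration 1 mt dr (fun=> false) l (vertex_program I #|V|)
  & forall v, size (ends (degree v) (mt v)) = degree v].
Proof.
pose w := (c * up_log 2 #|V|).+1.
pose dr v p := value (nth [::] [seq bits w (ident u) | u <- port v] p) < ident v.
have dirE s : direction dr s = (ident (head s) < ident (tail s)).
  rewrite /direction /dr (nth_map (head s)) ?number_lt // nth_number bitsK //.
  case: ids => _ /(_ (head s)) /andP[_ le]; apply: leq_ltn_trans le _.
  apply: (@leq_ltn_trans ((2 ^ up_log 2 #|V|) ^ c)).
    by case: (c) => // c'; rewrite leq_exp2r // up_logP.
  by rewrite -expnM mulnC ltn_exp2l.
exists (fun=> id), dr, (fun=> None); split; last first.
- move=> v; rewrite size_filter (eq_count (a2 := predT)) ?count_predT ?size_iota //.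
  by move=> p /=; rewrite eqxx.
- by exists (fun _ _ => false), (fun _ _ => false), (fun _ _ => None).
have mateE s : mate (fun=> id) s = s by rewrite /mate at_number.
split=> //; split=> [s|s|s|s]; rewrite ?mateE ?eqxx //; last first.
- by rewrite /terminal mateE.
rewrite !dirE /= -leqNgt [RHS]leq_eqVlt.
case: (eqVneq (ident (tail s)) (ident (head s))) => //= E.
by have := head_tail s; rewrite (proj1 ids _ _ E) eqxx.
Qed.

Lemma head_inj v : {in [set s | tail s == v] &, injective head}.
Proof.
move=> s t; rewrite !inE => /eqP sv /eqP tv hd.
by apply: val_inj; rewrite [val s]surjective_pairing [val t]surjective_pairing
   -/(tail s) -/(tail t) sv tv -/(head s) hd.
Qed.

Lemma card_heads v (P : pred dart) :
  #|[set u | [exists s, [&& tail s == v, P s & head s == u]]]| =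
  #|[set s | (tail s == v) && P s]|.
Proof.
rewrite -(card_in_imset (f := head)); last first.
  move=> s t; rewrite !inE => /andP[sv _] /andP[tv _].
  by apply: (@head_inj v); rewrite inE.
apply: eq_card => u; rewrite inE; apply/existsP/imsetP => [[s /and3P[sv Ps /eqP<-]]|[s]].
  by exists s; rewrite // inE sv.
by rewrite inE => /andP[sv Ps] ->; exists s; rewrite sv Ps eqxx.
Qed.

Lemma imbalance mt dr L v : system mt dr L ->
  let out := #|[set s | (tail s == v) && direction dr s]| in
  let inn := #|[set s | (tail s == v) && ~~ direction dr s]| in
  out <= inn + size (ends (degree v) (mt v)) /\
  inn <= out + size (ends (degree v) (mt v)).
Proof.
case=> wf [mateK _ dirM _] /=; rewrite size_ends_card //.
have half b : #|[set s | (tail s == v) && (direction dr s == b)]| <=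
    #|[set s | (tail s == v) && (direction dr s == ~~ b)]| +
    #|[set s | (tail s == v) && terminal (mate mt) s]|.
  set A := [set s | _]; set T := [set s | (_ == v) && terminal _ _].
  apply: (@leq_trans (#|A :\: T| + #|T|)).
    by rewrite -(cardsID T A) addnC leq_add2l subset_leq_card // subsetIr.
  rewrite leq_add2r -(card_imset _ (can_inj mateK)).
  apply/subset_leq_card/subsetP => t /imsetP[s].
  rewrite !inE => /andP[+ /andP[sv /eqP sb]] ->.
  by rewrite sv /= => nt; rewrite tail_mate // sv dirM // sb eqxx.
have -> : #|[set s | (tail s == v) && direction dr s]| =
    #|[set s | (tail s == v) && (direction dr s == true)]|.
  by apply: eq_card => s; rewrite !inE eqb_id.
have -> : #|[set s | (tail s == v) && ~~ direction dr s]| =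
    #|[set s | (tail s == v) && (direction dr s == false)]|.
  by apply: eq_card => s; rewrite !inE eqbF_neg.
by split; apply: half.
Qed.

Lemma final_system : exists mt dr L, [/\ system mt dr L,
  forall s, computed_arc (splitting c I) ident port (tail s) (head s) = direction dr s
  & forall v, 3 ^ I * size (ends (degree v) (mt v)) + 2 ^ I * 5 <=
      2 ^ I * degree v + 3 ^ I * 5].
Proof.
have [mt [dr [l [sys conf sz]]]] := initial_configuration.
have [V1|V1] := leqP #|V| 1.
  have no_dart s : False.
    by have /fintype_le1P eqV := V1; case/eqP: (head_tail s); apply: eqV.
  exists mt, dr, 0; split=> // v.
  have dv : degree v = 0.
    by case E: (degree v) => // [d]; have [|s] := @port_dart v 0; rewrite ?E.
  by rewrite sz dv !muln0 !add0n leq_mul2r; case: (I) => // J; rewrite leq_exp2r.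
have [mt' [dr' [o' [l' [L' [sys' [b [ow [lv [runT _ _]]]] ends']]]]]] :=
  full_configuration sys card_dart conf.
exists mt', dr', L'; split=> // [s|v]; last by rewrite -{2}(sz v).
have roundsE : rounds (splitting c I) #|V| = 1 + duration (vertex_program I #|V|).
  by rewrite /= leqNgt V1.
by rewrite /computed_arc head_port roundsE runT.
Qed.

Lemma degree_deg v : degree v = deg e v.
Proof.
case: (ports v) => uv portE; rewrite -(card_uniqP uv).
by apply: eq_card => u; rewrite inE portE.
Qed.

Lemma splitting_correct :
  let o := computed_arc (splitting c I) ident port in
  [/\ congest (splitting c I) ident port c.+1, is_orientation e o
    & forall v, exists2 E, 3 ^ I * E + 2 ^ I * 5 <= 2 ^ I * deg e v + 3 ^ I * 5 &
        outdeg o v <= indeg o v + E /\ indeg o v <= outdeg o v + E].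
Proof.
move=> o; have [mt [dr [L [sys oE bound]]]] := final_system.
have o_edge u v : o u v -> e u v by case/andP; case: (ports u) => _ ->.
have o_dart s : o (tail s) (head s) = direction dr s := oE s.
split.
- move=> T v p TR _; have V1 : 1 < #|V| by move: TR; rewrite [1 < _]ltnNge /=; case: ifP.
  have u0 : 0 < up_log 2 #|V| by rewrite up_log_gt0.
  case: T {TR} => [|T] /=; first by rewrite size_bits mulSn -add1n leq_add2r.
  have -> : size (send_message (receive_messages (run T v)
    [seq send_message (run T u) (index v (port u)) | u <- port v]) p) = 1.
    by case: (run T v) => // d m buf [|[[|k] i] prg].
  by rewrite muln_gt0 u0.
- split=> // u v euv; have := o_dart (exist _ (u, v) euv).
  have := o_dart (reverse (exist _ (u, v) euv)).
  rewrite (_ : direction dr (reverse _) = ~~ direction dr (exist _ (u, v) euv)).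
    by rewrite /tail /head /= => -> ->; case: direction.
  by case: sys => _ [].
move=> v; exists (size (ends (degree v) (mt v))); first by rewrite -degree_deg.
have -> : outdeg o v = #|[set s | (tail s == v) && direction dr s]|.
  rewrite -card_heads; apply: eq_card => u; rewrite !inE.
  apply/idP/existsP => [ovu|[s /and3P[/eqP<- ds /eqP<-]]]; last by rewrite o_dart.
  by exists (exist _ (v, u) (o_edge _ _ ovu)); rewrite -o_dart /tail /head /= !eqxx ovu.
have -> : indeg o v = #|[set s | (tail s == v) && ~~ direction dr s]|.
  have dirV s : direction dr (reverse s) = ~~ direction dr s by case: sys => _ [].
  rewrite -card_heads; apply: eq_card => u; rewrite !inE.
  apply/idP/existsP => [ouv|[s /and3P[/eqP<- + /eqP<-]]].
    exists (reverse (exist _ (u, v) (o_edge _ _ ouv))).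
    by rewrite dirV -o_dart /tail /head /= !eqxx ouv.
  by rewrite -dirV -o_dart.
exact: (imbalance v sys).
Qed.

End Simulation.

(** * Round complexity *)

Lemma duration_cat p1 p2 : duration (p1 ++ p2) = duration p1 + duration p2.
Proof. by rewrite /duration map_cat sumn_cat. Qed.

Lemma duration_stage D L :
  duration (stage_program D L) = L.+1 * (D * (2 * D + 2)).+1.
Proof.
have durE ins : duration [seq (L, i) | i <- ins] = L.+1 * size ins.
  by elim: ins => [|i ins]; rewrite /duration /= ?muln0 // mulnS => ->.
have size_phases K : size (flatten (nseq K (phase_program D))) = K * (2 * D + 2).
  elim: K => // K IH; rewrite mulSn -IH phases_programS size_cat; congr (_ + _).
  by rewrite /phase_program -cat1s !size_cat size_rev !size_map !size_iota /=; lia.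
by rewrite duration_cat durE size_phases /duration /= addn0 mulnS addnC.
Qed.

Lemma duration_full D L I :
  duration (full_program D L I) + L.+1 * (D * (2 * D + 2)).+1 =
  2 ^ I * (L.+1 * (D * (2 * D + 2)).+1).
Proof.
elim: I L => [|I IH] L; first by rewrite mul1n.
rewrite [full_program _ _ _]/(stage_program D L ++ full_program D L.*2.+1 I).
rewrite duration_cat duration_stage expnS; have := IH L.*2.+1.
rewrite -doubleS -(mul2n L.+1) -!mulnA; move: (L.+1 * _) (duration _) (2 ^ I) => X d A.
by rewrite mulnCA => <-; lia.
Qed.

Lemma duration_vertex I n : 1 < n ->
  (duration (vertex_program I n)).+1 <= 2 ^ I * (25 * up_log 2 n ^ 2).
Proof.
move=> n1; have u0 : 0 < up_log 2 n by rewrite up_log_gt0.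
rewrite /vertex_program; have := duration_full (2 * up_log 2 n).+1 0 I.
set D := (2 * _).+1; rewrite mul1n; set W := (D * _).+1 => durE.
have WB : W <= 25 * up_log 2 n ^ 2 by rewrite /W /D; nia.
apply: (@leq_trans (2 ^ I * W)); last by rewrite leq_mul2l WB orbT.
by rewrite -durE -addn1 leq_add2l.
Qed.

Lemma exp2_exp3 : 2 ^ 271 <= 3 ^ 171.
Proof.
have e1 : 2 ^ 84 <= 3 ^ 53 by lia.
have e2 : 2 ^ 19 <= 3 ^ 12 by lia.
have -> : 271 = 84 * 3 + 19 by [].
have -> : 171 = 53 * 3 + 12 by [].
by rewrite !expnD !expnM leq_mul ?leq_exp2r.
Qed.

Import Order.TTheory GRing.Theory Num.Theory.
Local Open Scope ring_scope.

Section Bounds.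

Variable R : realType.
Implicit Types eps : R.

Lemma powR_32 : 2 <= (3 / 2 : R) `^ (171 / 100).
Proof.
have p0 : 0 <= (3 / 2 : R) `^ (171 / 100) := powR_ge0 _ _.
rewrite -(@ler_pXn2r _ 100) ?nnegrE // -(powR_mulrn _ p0) -powRrM.
rewrite divfK ?pnatr_eq0 // powR_mulrn; last by lra.
rewrite expr_div_n ler_pdivlMr ?exprn_gt0 // -exprD.
by rewrite -!natrX ler_nat exp2_exp3.
Qed.

Lemma powR_32X J eps : 0 < eps -> eps <= (2 / 3) ^+ J ->
  2 ^+ J <= (1 / eps) `^ (171 / 100).
Proof.
move=> eps0 epsJ.
have J0 : 0 < (3 / 2 : R) ^+ J by rewrite exprn_gt0 //; lra.
have le : (3 / 2) ^+ J <= 1 / eps.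
  rewrite ler_pdivlMr //; apply: le_trans (ler_wpM2l (ltW J0) epsJ) _.
  by rewrite -exprMn (_ : 3 / 2 * (2 / 3) = 1 :> R) ?expr1n //; field.
apply: le_trans (ge0_ler_powR _ _ _ le); rewrite ?nnegrE ?(ltW J0) //; first last.
- by rewrite divr_ge0 // ltW.
- by lra.
rewrite -[X in _ <= X `^ _]powR_mulrn; last by lra.
rewrite -powRrM [J%:R * _]mulrC powRrM powR_mulrn ?powR_ge0 //.
by rewrite lerXn2r ?nnegrE ?powR_ge0 ?powR_32.
Qed.

Lemma exists_stages eps : 0 < eps -> exists2 I : nat, (2 / 3) ^+ I <= eps &
  forall J, I = J.+1 -> eps <= (2 / 3) ^+ J.
Proof.
move=> eps0.
have k2 k : k%:R <= 2 * (3 / 2 : R) ^+ k.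
  elim: k => [|k IH]; first by rewrite mulr1.
  have : 1 <= (3 / 2 : R) ^+ k by rewrite exprn_ege1 //; lra.
  by rewrite -[k.+1%:R]natr1 exprS; lra.
have ex : exists k : nat, (2 / 3) ^+ k <= eps.
  exists (Num.bound (2 / eps)); set k := Num.bound _.
  have K0 : 0 < (3 / 2 : R) ^+ k by rewrite exprn_gt0 //; lra.
  have := k2 k; have : 2 / eps < k%:R by rewrite archi_boundP // divr_ge0 // ltW.
  move=> /lt_le_trans /[apply]; rewrite ltr_pdivrMr // => lt.
  rewrite -(ler_pM2l K0) -exprMn (_ : 3 / 2 * (2 / 3) = 1 :> R) ?expr1n; last by field.
  lra.
case: (ex_minnP ex) => I ub minI; exists I => // J IJ.
by rewrite leNgt; apply/negP => /ltW/minI; rewrite IJ ltnn.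
Qed.

Lemma up_log_ln n : (1 < n)%N -> (up_log 2 n)%:R <= 2 / ln 2 * ln n%:R :> R.
Proof.
move=> n1; have l2 : 0 < ln 2 :> R by rewrite ln_gt0 // ltr1n.
have n0 : 0 < n%:R :> R by rewrite ltr0n ltnW.
have le2 : ln 2 <= ln n%:R :> R by rewrite ler_ln ?posrE // ler_nat.
have := up_log_gtn (isT : (1 < 2)%N) n1; have : (0 < up_log 2 n)%N by rewrite up_log_gt0.
case: (up_log 2 n) => // u _ /= /ltnW; rewrite -(ler_nat R) natrX => le.
rewrite mulrAC ler_pdivlMr //.
have : ln 2 *+ u <= ln n%:R :> R.
  by rewrite -lnXn // ler_ln ?posrE // exprn_gt0.
by rewrite -[u.+1%:R]natr1 -[_ *+ u]mulr_natl; lra.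
Qed.

Lemma rounds_le_bound c eps I n : 0 < eps ->
  (forall J, I = J.+1 -> eps <= (2 / 3) ^+ J) ->
  (rounds (splitting c I) n)%:Z <= round_bound (200 / ln 2 ^+ 2) eps n.
Proof.
move=> eps0 epsJ; rewrite /round_bound /=.
have l2 : 0 < ln 2 :> R by rewrite ln_gt0 // ltr1n.
have p0 : 0 < (1 / eps) `^ (171 / 100) by rewrite powR_gt0 // divr_gt0.
case: leqP => n1.
  rewrite ceil_ge0 (lt_le_trans (ltrN10 _)) // mulr_ge0 ?sqr_ge0 //.
  by rewrite mulr_ge0 ?(ltW p0) // divr_ge0 // sqr_ge0.
have ln0 : 0 < ln n%:R :> R by rewrite ln_gt0 // ltr1n.
have l20 : 0 < ln 2 ^+ 2 :> R by rewrite exprn_gt0 //; lra.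
case: I epsJ => [_|J epsJ].
  have -> : (duration (vertex_program 0 n)).+1 = 1%N by [].
  rewrite -gtz0_ge1 ceil_gt0 mulr_gt0 ?exprn_gt0 // mulr_gt0 //.
  by rewrite divr_gt0.
rewrite -(ler_int R) (le_trans _ (ceil_ge _)) //.
apply: (@le_trans _ _ ((2 ^ J.+1 * (25 * up_log 2 n ^ 2))%N%:R)).
  by rewrite ler_nat duration_vertex.
rewrite !natrM !natrX exprS.
have u2 : (up_log 2 n)%:R ^+ 2 <= (2 / ln 2 * ln n%:R) ^+ 2 :> R.
  by rewrite lerXn2r ?nnegrE ?up_log_ln // mulr_ge0 ?divr_ge0 ?ltW.
have := ler_pM _ _ (powR_32X eps0 (epsJ _ erefl)) u2.
rewrite exprn_ge0 // exprn_ge0 // => /(_ isT isT) le.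
have -> : 200 / ln 2 ^+ 2 * (1 / eps) `^ (171 / 100) * ln n%:R ^+ 2 =
  50 * ((1 / eps) `^ (171 / 100) * (2 / ln 2 * ln n%:R) ^+ 2) :> R.
  by field; rewrite gt_eqF.
lra.
Qed.

Lemma imbalance_le eps I E d : (2 / 3) ^+ I <= eps ->
  (3 ^ I * E + 2 ^ I * 5 <= 2 ^ I * d + 3 ^ I * 5)%N -> E%:R <= eps * d%:R + 12.
Proof.
move=> epsI; rewrite -(ler_nat R) !natrD !natrM !natrX => le.
have t0 : 0 < 3 ^+ I :> R by rewrite exprn_gt0 //; lra.
rewrite -(ler_pM2l t0); have d0 : 0 <= d%:R :> R by rewrite ler0n.
have : 2 ^+ I <= 3 ^+ I * eps.
  by rewrite mulrC -ler_pdivrMr // -expr_div_n.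
move/(ler_wpM2r d0); have : 0 <= 2 ^+ I :> R by rewrite exprn_ge0.
by rewrite mulrDr mulrA; lra.
Qed.

End Bounds.

Theorem theorem16 (R : realType) (c : nat) :
  exists (b : nat) (C : R), forall eps : R, 0 < eps ->
  exists A : algorithm,
    (forall n : nat, (rounds A n)%:Z <= round_bound C eps n) /\
    forall (V : finType) (e : rel V) (ident : V -> nat) (port : V -> seq V),
      simple_graph e -> unique_ids c ident -> port_numbering e port ->
      let o := computed_arc A ident port in
      [/\ congest A ident port b,
          is_orientation e o
        & forall v : V,
            `| (outdeg o v)%:R - (indeg o v)%:R | <= eps * (deg e v)%:R + 12 ].
Proof.
exists c.+1, (200 / ln 2 ^+ 2) => eps eps0.
have [I epsI minI] := exists_stages eps0.
exists (splitting c I); split=> [n|V e ident port e_simple ids ports o].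
  exact: rounds_le_bound.
have [con ori bal] := splitting_correct I e_simple ids ports.
split=> // v; have [E /(imbalance_le epsI) le [out_in in_out]] := bal v.
apply: le_trans le; rewrite ler_norml; move: out_in in_out.
by rewrite -!(ler_nat R) !natrD -/o; lra.
Qed.
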